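(* Let $\mathcal{A}^{[m,n]}=\bigoplus_{\mathsf{g}\in\mathsf{G}^{[n']}}\mathcal{A}(\mathsf{g})$ be a nonzero polyadic $\Bbbk$-algebra with $n$-ary multiplication that is strongly graded by a commutative $n'$-ary group $\mathsf{G}^{[n']}$. Then the arity of the algebra multiplication and the arity of the grading group coincide: $$n'=n.$$
   Context: **Polyadic operations.** An $n$-ary operation is totally associative if the result of composing it with itself does not depend on the position of the inner operation. An $n'$-ary group is a set $G$ with a totally associative $n'$-ary operation $\mu_g^{[n']}$ such that every $\mathsf{g}\in G$ has a unique querelement $\bar{\mathsf{g}}$, defined by $\mu_g^{[n']}[\mathsf{g},\ldots,\mathsf{g},\bar{\mathsf{g}}]=\mathsf{g}$ ($n'-1$ copies of $\mathsf{g}$). No identity element is required. Grading groups are assumed commutative. **Polyadic algebra.** $\mathcal{A}^{[m,n]}=\langle A\mid\nu_a^{[m]},\mu_a^{[n]}\rangle$ is an algebra over an ordinary (binary) field $\Bbbk$ with a totally associative $m$-ary addition $\nu_a^{[m]}$ and a totally associative $n$-ary multiplication $\mu_a^{[n]}$ that is distributive over the addition and compatible with scalars. Standing assumption: $\mu_a^{[n]}$ and $\mu_g^{[n']}$ are nonderived, i.e. they are not compositions of binary operations only (in particular $G$ is not a one-element group). **Strong grading.** $\mathcal{A}^{[m,n]}$ is strongly $\mathsf{G}$-graded if it is a direct sum of $\Bbbk$-vector spaces $\mathcal{A}(\mathsf{g})$, $\mathsf{g}\in\mathsf{G}^{[n']}$ (distinct components have no nonzero element in common; for a strongly graded nonzero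 algebra no component is zero), and $$\mu_a^{[n]}[\mathcal{A}(\mathsf{g}_1),\mathcal{A}(\mathsf{g}_2),\ldots,\mathcal{A}(\mathsf{g}_n)]=\mathcal{A}(\mu_g^{[n']}[\mathsf{g}_1,\mathsf{g}_2,\ldots,\mathsf{g}_{n'}])$$ for all choices of $\mathsf{g}_1,\mathsf{g}_2,\ldots\in\mathsf{G}^{[n']}$. Here the word of degrees $\mathsf{g}_1,\ldots,\mathsf{g}_n$ of the factors on the left is the word $\mathsf{g}_1,\ldots,\mathsf{g}_{n'}$ multiplied in the grading group on the right. *)

(* Defs.v *)
From mathcomp Require Import all_boot all_fingroup all_algebra.
From mathcomp Require Import mathcomp_extra boolp classical_sets.

Set Implicit Arguments.
Unset Strict Implicit.
Unset Printing Implicit Defensive.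

Import GRing.Theory.

Local Open Scope ring_scope.
Local Open Scope classical_set_scope.

Section PolyadicOperations.
Variables (T : Type) (n : nat).
Implicit Types op : n.-tuple T -> T.

(* The word w is read as an infinite sequence of letters. *)
Definition letters (w : nat -> T) : n.-tuple T := [tuple w i | i < n].

Definition set_slot (x : n.-tuple T) (i : 'I_n) (t : T) : n.-tuple T :=
  [tuple if j == i then t else tnth x j | j < n].

(* op [w_0, .., w_(i-1), op [w_i, .., w_(i+n-1)], w_(i+n), .., w_(2n-2)] *)
Definition nested op (w : nat -> T) (i : 'I_n) : T :=
  op [tuple if (j < i)%N then w j
            else if j == i then op (letters (fun l => w (i + l)%N))
            else w (j + n.-1)%N | j < n].

Definition totally_associative op : Prop :=
  forall (w : nat -> T) (i j : 'I_n), nested op w i = nested op w j.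

Definition polyadic_commutative op : Prop :=
  forall (s : 'S_n) (x : n.-tuple T), op [tuple tnth x (s i) | i < n] = op x.

Definition is_querelement op (g q : T) : Prop :=
  op (letters (fun i => if (i < n.-1)%N then g else q)) = g.

Definition polyadic_group op : Prop :=
  totally_associative op /\ (forall g, exists! q, is_querelement op g q).

(* op [x_0, .., x_(n-1)] = x_0 * .. * x_(n-1) for a binary semigroup law *)
Definition derived op : Prop :=
  exists b : T -> T -> T, associative b /\
    forall (t0 : T) (x : n.-tuple T), op x = foldl b (head t0 x) (behead x).

(* Being nonderived is a restriction only for arity at least 3: a binary
   operation, which is trivially composed of itself, is not excluded. *)
Definition nonderived op : Prop := (2 < n)%N -> ~ derived op.

End PolyadicOperations.

Section PolyadicAlgebra.
Variables (k : fieldType) (A : lmodType k) (m n : nat).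
Variables (nu : m.-tuple A -> A) (mu : n.-tuple A -> A).

(* nu is not assumed to be the iterated sum of the vector space A, only to be
   a k-linear map A^m -> A; e.g. x - y + z is a legitimate ternary addition. *)
Record polyadic_algebra : Prop := PolyadicAlgebra {
  addition_assoc : totally_associative nu;
  addition_linear : forall (c : k) (x y : m.-tuple A),
    nu [tuple c *: tnth x i + tnth y i | i < m] = c *: nu x + nu y;
  multiplication_assoc : totally_associative mu;
  multiplication_distr : forall (i : 'I_n) (a : n.-tuple A) (x : m.-tuple A),
    mu (set_slot a i (nu x)) =
    nu [tuple mu (set_slot a i (tnth x j)) | j < m];
  multiplication_scale : forall (i : 'I_n) (a : n.-tuple A) (c : k) (x : A),
    mu (set_slot a i (c *: x)) = c *: mu (set_slot a i x)
}.

Definition is_subspace (V : set A) : Prop :=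
  V 0 /\ forall (c : k) (x y : A), V x -> V y -> V (c *: x + y).

Definition addition_closed (V : set A) : Prop :=
  (forall x : m.-tuple A, (forall i, V (tnth x i)) -> V (nu x)) /\
  (forall (c : k) (x : A), V x -> V (c *: x)).

(* As usual for products of subspaces, mu [V_0, .., V_(n-1)] is the set of all
   sums (here: iterated nu-sums) of products, not just the set of products. *)
Definition product_space (V : n.-tuple (set A)) : set A :=
  smallest addition_closed
    [set mu x | x in [set x : n.-tuple A | forall i, tnth V i (tnth x i)]].

Definition is_direct_sum (G : Type) (comp : G -> set A) : Prop :=
  [/\ forall g, is_subspace (comp g),
      forall a : A, exists (N : nat) (g : 'I_N -> G) (x : 'I_N -> A),
        (forall i, comp (g i) (x i)) /\ a = \sum_(i < N) x i
    & forall (N : nat) (g : 'I_N -> G) (x : 'I_N -> A),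
        injective g -> (forall i, comp (g i) (x i)) ->
        \sum_(i < N) x i = 0 -> forall i, x i = 0].

(* The degrees g_0, g_1, .. are letters of one common word: the first n of them
   are the degrees of the factors, the first n' of them are multiplied in G. *)
Definition strongly_graded (G : Type) (n' : nat) (mug : n'.-tuple G -> G)
    (comp : G -> set A) : Prop :=
  is_direct_sum comp /\
  forall g : nat -> G,
    product_space (letters n (fun i => comp (g i))) = comp (mug (letters n' g)).

End PolyadicAlgebra.

(* Main.v *)
Require Import Defs.
From mathcomp Require Import all_boot all_fingroup all_algebra.
From mathcomp Require Import mathcomp_extra boolp classical_sets.

(** The strong grading condition equates a product of n components with the
    component of a product of n' degrees, both read off one word of degrees;
    whichever arity is larger, the extra letters of the word cannot matter.
    In both cases this yields, for a degree g with nonzero component,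
      mug [g, .., g, h] = g   for every h,
    so that every h is a querelement of g.  Querelements are unique, hence G
    has a single element, which is excluded.

    If n < n', the product of components does not see the last letter of the
    degree word; writing g as mug [g, .., g, q] with q its querelement, q may
    be replaced by any h without changing the component, and distinct degrees
    cannot share a nonzero component ([component_inj]).

    If n' < n, the degree of a product of n factors does not see its last
    factor.  Associativity of mu makes this contradictory:
      mu [mu [a_0, ..], a_n, .., a_(2n-2)] = mu [a_0, .., mu [a_(n-1), ..]].
    On the right, the degree is that of a_0, .., a_(n'-1) alone, which may be
    arranged to be g; on the left, it is mug of g and of the degrees of
    a_n, .., a_(n+n'-2), which are arbitrary.  It remains to find such factors
    with nonzero product: since comp g is spanned by products, a vanishing of
    all of them would make comp g zero ([long_product_degree]). *)

Set Implicit Arguments.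
Unset Strict Implicit.
Unset Printing Implicit Defensive.

Import GRing.Theory.

Local Open Scope ring_scope.

Section Words.
Variable T : Type.

Lemma eq_letters n (u v : nat -> T) :
  (forall i, (i < n)%N -> u i = v i) -> letters n u = letters n v.
Proof. by move=> uv; apply: eq_from_tnth => i; rewrite !tnth_mktuple uv. Qed.

Lemma nested_first n (op : n.-tuple T -> T) (w : nat -> T) (i : 'I_n) :
  i = 0%N :> nat ->
  nested op w i = op (letters n (fun j =>
    if j == 0%N then op (letters n w) else w (j + n.-1)%N)).
Proof.
move=> i0; congr op; apply: eq_from_tnth => j; rewrite !tnth_mktuple.
rewrite -(inj_eq val_inj) /= i0 ltn0; by case: eqP.
Qed.

Lemma nested_last n (op : n.-tuple T -> T) (w : nat -> T) (i : 'I_n) :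
  i = n.-1 :> nat ->
  nested op w i =
  op (set_slot (letters n w) i (op (letters n (fun l => w (n.-1 + l)%N)))).
Proof.
move=> iE; congr op; apply: eq_from_tnth => j; rewrite !tnth_mktuple.
case: ltnP => [ji|ij]; first by rewrite -(inj_eq val_inj) ltn_eqF.
have ->: j = i.
  apply/val_inj/eqP; rewrite eqn_leq ij andbT /= iE.
  by rewrite -ltnS (ltn_predK (ltn_ord i)).
by rewrite eqxx iE.
Qed.

(** A degree on which the last letter has no influence has all elements of G
    as querelements, so uniqueness collapses G. *)
Lemma querelement_collapse n (op : n.-tuple T -> T) (g : T) :
  polyadic_group op ->
  (forall h, is_querelement op g h) -> forall h h' : T, h = h'.
Proof.
move=> [_ /(_ g)[q [_ q_uniq]]] all_q h h'.
by rewrite -(q_uniq h) // -(q_uniq h').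
Qed.

End Words.

Section StrongGrading.
Variables (k : fieldType) (A : lmodType k) (G : Type) (m n n' : nat).
Variables (nu : m.-tuple A -> A) (mu : n.-tuple A -> A).
Variables (mug : n'.-tuple G -> G) (comp : G -> set A).

(** Otherwise x and - x, in two different components, would violate the
    independence of the components. *)
Lemma component_inj (g h : G) (x : A) :
  is_direct_sum comp -> comp g x -> comp h x -> x <> 0 -> g = h.
Proof.
move=> [sub _ indep] gx hx x0; apply: contrapT => gh; apply: x0.
have hNx : comp h (- x).
  by have [h0 /(_ (-1) x 0 hx h0)] := sub h; rewrite scaleN1r addr0.
pose d (i : 'I_2) := if i == ord0 then g else h.
pose y (i : 'I_2) := if i == ord0 then x else - x.
apply: (indep _ d y _ _ _ ord0).
- move=> i j; rewrite /d; case: (eqVneq i ord0) => [->|i0];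
    case: (eqVneq j ord0) => [->|j0] // e; try by case: gh.
  by apply/val_inj; move: i j i0 j0 {e} => [[|[|?]] ?] [[|[|?]] ?].
- by move=> i; rewrite /y /d; case: (i == ord0).
- by rewrite !big_ord_recl big_ord0 /y /= addr0 subrr.
Qed.

Lemma nonzero_component :
  is_direct_sum comp -> (exists a : A, a <> 0) ->
  exists g x, comp g x /\ x <> 0.
Proof.
move=> [_ gen _] [a a0]; apply: contrapT => none; apply: a0.
have [N [g [x [gx ->]]]] := gen a; apply: big1 => i _.
by apply: contrapT => xi; apply: none; exists (g i), (x i).
Qed.

(** Addition-closed sets serve as kernels below: a spanning set that lies in
    one spans nothing outside of it. *)
Lemma product_space_outside (V : n.-tuple (set A)) (K : set A) (x : A) :
  addition_closed nu K -> product_space nu mu V x -> ~ K x ->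
  exists y : n.-tuple A, (forall i, tnth V i (tnth y i)) /\ ~ K (mu y).
Proof.
move=> Kc Vx Kx; apply: contrapT => none; apply: Kx; apply: Vx; split=> //.
by move=> _ [y Vy <-]; apply: contrapT => Ky; apply: none; exists y.
Qed.

Hypothesis algA : polyadic_algebra nu mu.

Lemma addition_zero (x : m.-tuple A) : (forall i, tnth x i = 0) -> nu x = 0.
Proof.
move=> x0; have := addition_linear algA 1 x x.
rewrite (_ : [tuple _ | _ < _] = x).
  by rewrite scale1r -[in LHS](addr0 (nu x)) => /addrI.
by apply: eq_from_tnth => i; rewrite tnth_mktuple !x0 scaler0 addr0.
Qed.

Lemma zero_addition_closed : addition_closed nu [set x | x = 0].
Proof. by split=> [x /addition_zero//|c x /= ->]; rewrite scaler0. Qed.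

Lemma slot_kernel_addition_closed (a : n.-tuple A) (i : 'I_n) :
  addition_closed nu [set x | mu (set_slot a i x) = 0].
Proof.
split=> [x x0|c x /= x0] /=.
  rewrite (multiplication_distr algA); apply: addition_zero => j.
  by rewrite tnth_mktuple; apply: x0.
by rewrite (multiplication_scale algA) x0 scaler0.
Qed.

Hypothesis gradA : strongly_graded nu mu mug comp.

Lemma homogeneous_product (g : nat -> G) (a : nat -> A) :
  (forall i, (i < n)%N -> comp (g i) (a i)) ->
  comp (mug (letters n' g)) (mu (letters n a)).
Proof.
move=> ga; rewrite -gradA.2; apply: sub_gen_smallest.
by exists (letters n a) => // i /=; rewrite !tnth_mktuple; apply: ga.
Qed.

Lemma homogeneous_outside (g : nat -> G) (K : set A) (x : A) :
  addition_closed nu K -> comp (mug (letters n' g)) x -> ~ K x ->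
  exists a : nat -> A, (forall i, (i < n)%N -> comp (g i) (a i)) /\
    ~ K (mu (letters n a)).
Proof.
rewrite -gradA.2 => Kc gx Kx.
have [y [gy Ky]] := product_space_outside Kc gx Kx.
exists (nth 0 y); split=> [i lt_in|].
  have := gy (Ordinal lt_in); rewrite tnth_mktuple /=.
  by rewrite (tnth_nth 0).
rewrite (_ : letters n _ = y) //.
by apply: eq_from_tnth => i; rewrite tnth_mktuple (tnth_nth 0).
Qed.

(** The two ways of bracketing a product of 2n-1 factors have the degrees
    mug u and mug v: with the inner product in the last slot, only letters of
    u count; with the inner product, of degree v 0, in the first slot, the
    outer product has degree word v.  The factors are chosen so that the
    product does not vanish, first in comp (mug u), then by expanding its
    last factor, of degree mug v, into a product. *)
Lemma long_product_degree (u v : nat -> G) (x : A) :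
  (1 < n)%N -> (n' < n)%N -> v 0%N = mug (letters n' u) ->
  comp (mug (letters n' u)) x -> x <> 0 ->
  mug (letters n' u) = mug (letters n' v).
Proof.
move=> n1 n'n v0 ux x0.
have n0 : (0 < n)%N := ltnW n1.
have predn_lt : (n.-1 < n)%N by rewrite ltn_predL.
have n'p : (n' <= n.-1)%N by rewrite -ltnS prednK.
pose first := Ordinal n0; pose last := Ordinal predn_lt.
(* Only the first n' <= n - 1 letters of u count, so the degree of the last
   factor may be prescribed to be that of the inner product. *)
pose u' i := if (i < n.-1)%N then u i else mug (letters n' v).
have u'E : letters n' u' = letters n' u.
  by apply: eq_letters => i lt_in'; rewrite /u' (leq_trans lt_in').
rewrite -u'E in ux.
have [a [u'a a0]] := homogeneous_outside zero_addition_closed ux x0.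
have va : comp (mug (letters n' v)) (a n.-1).
  by have := u'a _ predn_lt; rewrite /u' ltnn.
have aK : mu (set_slot (letters n a) last (a n.-1)) <> 0.
  rewrite (_ : set_slot _ _ _ = letters n a) //.
  by apply: eq_from_tnth => i; rewrite !tnth_mktuple; case: eqP => // ->.
have [b [vb b0]] :=
  homogeneous_outside (slot_kernel_addition_closed (letters n a) last) va aK.
(* The 2n-1 factors, and their degrees; w has v 0 in position n - 1, which is
   again beyond the letters that count in the inner product mu (letters n c). *)
pose c l := if (l < n.-1)%N then a l else b (l - n.-1)%N.
pose w l := if (l < n.-1)%N then u l else v (l - n.-1)%N.
have c_tail l : c (n.-1 + l)%N = b l by rewrite /c ltnNge leq_addr /= addKn.
have wc l : (l < n)%N -> comp (w l) (c l).
  move=> ln; rewrite /w /c; case: ltnP => [lp|_].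
    by have := u'a _ ln; rewrite /u' lp.
  by apply: vb; apply: leq_ltn_trans (leq_subr _ _) ln.
have c_last : nested mu c last =
    mu (set_slot (letters n a) last (mu (letters n b))).
  rewrite nested_last //; congr mu; apply: eq_from_tnth => j.
  rewrite !tnth_mktuple; case: eqP => [_|/eqP jlast].
    by congr mu; apply: eq_letters => l _.
  rewrite -(inj_eq val_inj) /= in jlast.
  by rewrite /c ltn_neqAle jlast -ltnS prednK // ltn_ord.
apply: (component_inj gradA.1 (x := nested mu c last)); last by rewrite c_last.
- rewrite c_last -u'E; set t := set_slot _ _ _.
  rewrite (_ : t = letters n (fun j =>
    if j == n.-1 then mu (letters n b) else a j)); last first.
    by apply: eq_from_tnth => j; rewrite !tnth_mktuple -(inj_eq val_inj).
  apply: homogeneous_product => i lt_in; case: eqP => [->|_]; last exact: u'a.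
  by rewrite /u' ltnn; apply: homogeneous_product.
- rewrite (multiplication_assoc algA c last first) nested_first //.
  apply: homogeneous_product => i lt_in; case: eqP => [->|_].
    rewrite v0 (_ : letters n' u = letters n' w).
      exact: homogeneous_product.
    by apply: eq_letters => j ltj; rewrite /w (leq_trans ltj).
  by rewrite addnC c_tail; apply: vb.
Qed.

End StrongGrading.

Theorem proposition3p6 (k : fieldType) (A : lmodType k) (G : Type)
    (m n n' : nat) (hm : (1 < m)%N) (hn : (1 < n)%N) (hn' : (1 < n')%N)
    (nu : m.-tuple A -> A) (mu : n.-tuple A -> A) (mug : n'.-tuple G -> G)
    (comp : G -> set A)
    (algA : polyadic_algebra nu mu) (A_neq0 : exists a : A, a <> 0)
    (grpG : polyadic_group mug) (comG : polyadic_commutative mug)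
    (ndA : nonderived mu) (ndG : nonderived mug)
    (G_neq1 : exists g h : G, g <> h)
    (gradA : strongly_graded nu mu mug comp) :
  n' = n.
Proof.
have [g [x [gx x0]]] := nonzero_component gradA.1 A_neq0.
have [q [gq _]] := grpG.2 g.
pose word h i := if (i < n'.-1)%N then g else h.
case: (ltngtP n' n) => // [n'n|nn']; exfalso; case: G_neq1 => h [h' []];
  apply: (querelement_collapse (g := g) grpG) => {h h'} h.
- have ux : comp (mug (letters n' (word q))) x by rewrite gq.
  have v0 : word h 0%N = mug (letters n' (word q)).
    by rewrite gq /word -ltnS prednK ?hn' // ltnW.
  rewrite /is_querelement.
  by rewrite -(long_product_degree algA gradA hn n'n v0 ux x0) gq.
- apply: (component_inj gradA.1 (x := x)) => //.
  rewrite -gradA.2 (_ : letters n _ = letters n (fun i => comp (word q i))).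
    by rewrite gradA.2 gq.
  apply: eq_letters => i lt_in; rewrite /word ifT //.
    by rewrite ifT // -ltnS prednK ?(leq_trans _ nn') // ltnW.
  by rewrite -ltnS prednK ?(leq_trans _ nn') // ltnW.
Qed.
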